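(* Let $N\ge 1$ and let $0\le Y_0\le N$ be an integer with $Y_0\equiv N \pmod 2$. Let $H$ be the area random walk of length $N$ started at $H(0)=Y_0$. Then for every integer $n\ge 1$ and every $X\in\{0,\dots,N-1\}$, $$\mathbb{E}[H(X+1)^n]=1+\sum_{k=1}^n\left(\binom{n}{k}-\bigl(1+(-1)^{n-k}\bigr)\binom{n}{k-1}\frac{1}{N-X}\right)\mathbb{E}[H(X)^k],$$ with $\mathbb{E}[H(0)^n]=Y_0^n$.
   Context: The area random walk of length $N$ started at $Y_0$ (with $0\le Y_0\le N$, $Y_0\equiv N\pmod 2$) is the Markov chain $H(0),H(1),\dots,H(N)$ with values in the nonnegative integers, $H(0)=Y_0$, and transition probabilities, for $0\le X\le N-1$, $$\mathbb{P}[H(X+1)=Y+1\mid H(X)=Y]=1-\frac{Y}{N-X},\qquad \mathbb{P}[H(X+1)=Y-1\mid H(X)=Y]=\frac{Y}{N-X}.$$ The parity condition guarantees that $0\le H(X)\le N-X$ for all $X$, so these are genuine probabilities, and $H(N)=0$. *)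

(* Defs.v *)
From HB Require Import structures.
From mathcomp Require Import all_boot all_order all_algebra.
From mathcomp Require Import all_classical all_reals all_analysis.

Set Implicit Arguments.
Unset Strict Implicit.
Unset Printing Implicit Defensive.

Import Order.TTheory GRing.Theory Num.Theory.
Local Open Scope classical_set_scope.
Local Open Scope ring_scope.

(* P[A | B]; only meaningful when P B != 0 (it is 0 otherwise). *)
Definition cond_prob (R : realType) (d : measure_display)
    (T : measurableType d) (P : probability T R) (A B : set T) : R :=
  fine (P (A `&` B)) / fine (P B).

(* A chain of length N is a process indexed by nat of which only the times
   0, ..., N are constrained. *)
Definition markov_property (R : realType) (d : measure_display)
    (T : measurableType d) (P : probability T R) (N : nat)
    (H : nat -> {RV P >-> nat}) : Prop :=
  forall (X : nat) (h : nat -> nat) (z : nat), (X < N)%N ->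
    P [set w | forall i, (i <= X)%N -> H i w = h i] != 0%E ->
    cond_prob P [set w | H X.+1 w = z]
                [set w | forall i, (i <= X)%N -> H i w = h i]
    = cond_prob P [set w | H X.+1 w = z] [set w | H X w = h X].

(* The down-step event is stated in int: for Y = 0 it is the empty event
   H(X+1) = -1, whereas Y.-1 would be 0. *)
Record area_random_walk (R : realType) (d : measure_display)
    (T : measurableType d) (P : probability T R) (N Y0 : nat)
    (H : nat -> {RV P >-> nat}) : Prop := AreaRandomWalk {
  arw_start : P [set w | H 0%N w = Y0] = 1%E;
  arw_markov : markov_property N H;
  arw_up : forall X Y : nat, (X < N)%N ->
    P [set w | H X w = Y] != 0%E ->
    cond_prob P [set w | H X.+1 w = Y.+1] [set w | H X w = Y]
    = 1 - Y%:R / (N%:R - X%:R);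
  arw_down : forall X Y : nat, (X < N)%N ->
    P [set w | H X w = Y] != 0%E ->
    cond_prob P [set w | (H X.+1 w)%:Z = Y%:Z - 1] [set w | H X w = Y]
    = Y%:R / (N%:R - X%:R) }.

(* Main.v *)
(** The up- and down-step probabilities out of each state sum to 1, so almost
    surely every step is +1 or -1 and H(X) <= Y0 + X. Hence all expectations are
    finite sums over the atoms of H(X), and conditioning on H(X) gives
      E[f(H(X+1))] = E[(1 - p) f(H(X) + 1) + p f(H(X) - 1)],  p = H(X) / (N - X).
    The recursion is the binomial expansion of this for f(x) = x^n. *)
Require Import Defs.
From HB Require Import structures.
From mathcomp Require Import all_boot all_order all_algebra.
From mathcomp Require Import all_classical all_reals all_analysis.
From mathcomp Require Import measurable_realfun ring zify.

Import Order.TTheory GRing.Theory Num.Theory.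
Local Open Scope classical_set_scope.
Local Open Scope ring_scope.

(** Linearity of the integral. Equality is asked only almost everywhere because the walk is
    controlled only up to null sets. *)
Lemma expectation_ae_sum_indic (R : realType) (d : measure_display)
    (T : measurableType d) (P : probability T R) (I : finType) (f : T -> R)
    (c : I -> R) (A : I -> set T) :
    measurable_fun setT f -> (forall i, measurable (A i)) ->
    {ae P, forall w, f w = \sum_i c i * \1_(A i) w} ->
  ('E_P[f] = (\sum_i c i * fine (P (A i)))%:E)%E.
Proof.
move=> mf mA fE; rewrite unlock.
have intA i : P.-integrable setT (fun w => (c i)%:E * (\1_(A i) w)%:E)%E.
  by apply: integrableZl => //; exact: integrable_indic.
rewrite (ae_eq_integral (fun w => \sum_i ((c i)%:E * (\1_(A i) w)%:E))%E) //.
- rewrite integral_sum // -sumEFin; apply: eq_bigr => i _.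
  rewrite integralZl //; last exact: integrable_indic.
  by rewrite integral_indic // setIT EFinM fineK // fin_num_measure.
- exact/measurable_EFinP.
- by apply: emeasurable_sum => i; case/integrableP: (intA i).
- apply: filterS fE => w /= -> _.
  by rewrite -sumEFin; apply: eq_bigr => i _; rewrite EFinM.
Qed.

(** If [P B = 0], both sides vanish, so the product form holds for every state, including those the
    walk never visits. *)
Lemma cond_prob_mul (R : realType) (d : measure_display)
    (T : measurableType d) (P : probability T R) (A B : set T) (q : R) :
    measurable A -> measurable B ->
    (P B != 0%E -> cond_prob P A B = q) ->
  fine (P (A `&` B)) = q * fine (P B).
Proof.
move=> mA mB; have [PB0 _|PB0 /(_ isT) <-] := eqVneq (P B) 0%E.
  rewrite PB0 mulr0 (_ : P _ = 0%E) //.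
  by apply: subset_measure0 PB0 => //; exact: measurableI.
rewrite /cond_prob mulfVK //.
by rewrite fine_eq0 // fin_num_measure.
Qed.

Section walk.
Variables (R : realType) (d : measure_display) (T : measurableType d).
Variables (P : probability T R) (N Y0 : nat) (H : nat -> {RV P >-> nat}).
Hypothesis hH : area_random_walk N Y0 H.

Local Notation at_ X y := [set w | H X w = y].
Local Notation up X y := [set w | H X.+1 w = y.+1].
Local Notation down X y := [set w | (H X.+1 w)%:Z = y%:Z - 1].

Lemma measurable_walk_preimage X (B : set nat) :
  measurable [set w | B (H X w)].
Proof. by rewrite -[X in measurable X]setTI; exact: measurable_funP. Qed.

Lemma measurable_walk_comp X (f : nat -> R) :
  measurable_fun setT (fun w => f (H X w)).
Proof. by apply: measurableT_comp => //; exact: measurable_funP. Qed.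

Lemma prob_up X y : (X < N)%N ->
  fine (P (up X y `&` at_ X y)) = (1 - y%:R / (N%:R - X%:R)) * fine (P (at_ X y)).
Proof.
move=> XN; apply: cond_prob_mul.
- exact: (measurable_walk_preimage X.+1 [set y.+1]).
- exact: (measurable_walk_preimage X [set y]).
- exact: arw_up hH _ _ XN.
Qed.

Lemma prob_down X y : (X < N)%N ->
  fine (P (down X y `&` at_ X y)) = y%:R / (N%:R - X%:R) * fine (P (at_ X y)).
Proof.
move=> XN; apply: cond_prob_mul.
- exact: (measurable_walk_preimage X.+1 [set k | k%:Z = y%:Z - 1]).
- exact: (measurable_walk_preimage X [set y]).
- exact: arw_down hH _ _ XN.
Qed.

Lemma ae_unit_step X : (X < N)%N ->
  {ae P, forall w, H X.+1 w = (H X w).+1 \/ (H X.+1 w)%:Z = (H X w)%:Z - 1}.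
Proof.
move=> XN.
(* With the state [y] fixed, it remains to combine countably many null sets. *)
suff stepy : {ae P, forall w y, H X w = y ->
    H X.+1 w = y.+1 \/ (H X.+1 w)%:Z = y%:Z - 1}.
  by apply: filterS stepy => w; exact.
apply: ae_foralln => y.
have mB := measurable_walk_preimage X [set y].
have mU := measurable_walk_preimage X.+1 [set y.+1].
have mD := measurable_walk_preimage X.+1 [set k | k%:Z = y%:Z - 1].
rewrite /= in mB mU mD.
(* The weights [1 - p] and [p] add up to 1, so the two disjoint steps exhaust the mass of the atom
   and the rest of it is null. *)
have split_at : P (at_ X y) = (P (up X y `&` at_ X y) + P (down X y `&` at_ X y))%E.
  rewrite -[LHS]fineK ?fin_num_measure // -[X in (X + _)%E]fineK; last first.
    by rewrite fin_num_measure //; exact: measurableI.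
  rewrite -[X in (_ + X)%E]fineK; last first.
    by rewrite fin_num_measure //; exact: measurableI.
  by rewrite prob_up // prob_down // -EFinD; congr EFin; ring.
exists (at_ X y `\` (up X y `|` down X y)); split.
- by apply: measurableD => //; exact: measurableU.
- rewrite measureD //; [|exact: measurableU|by rewrite ltey_eq fin_num_measure].
  rewrite setIC setIUl measureU //; [|exact: measurableI..|]; last first.
    by apply/seteqP; split => // w [[/= U _] [/= D _]]; exfalso; lia.
  transitivity (P (at_ X y) - P (at_ X y))%E; last by rewrite subee // fin_num_measure.
  by congr (_ - _)%E; exact: esym split_at.
- by move=> w /= /not_implyP [].
Qed.

Lemma ae_start : {ae P, forall w, H 0%N w = Y0}.
Proof.
have mA := measurable_walk_preimage 0 [set Y0]; rewrite /= in mA.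
exists (~` [set w | H 0%N w = Y0]); split.
- exact: measurableC.
- by rewrite probability_setC // (arw_start hH) subee.
- by move=> w /= H0; exact: H0.
Qed.

(** Each step raises the walk by at most 1. This crude bound serves only to make the sums over
    states finite. *)
Lemma ae_walk_bound X : (X <= N)%N -> {ae P, forall w, (H X w < (Y0 + X).+1)%N}.
Proof.
elim: X => [_|X IH XN].
  by apply: filterS ae_start => w ->; rewrite addn0.
apply: filterS2 (IH (ltnW XN)) (ae_unit_step _ XN) => w bX step; lia.
Qed.

Lemma expectation_walk X (f : nat -> R) : (X <= N)%N ->
  ('E_P[fun w => f (H X w)]
   = (\sum_(y < (Y0 + X).+1) f y * fine (P (at_ X y)))%:E)%E.
Proof.
move=> XN; apply: expectation_ae_sum_indic.
- exact: measurable_walk_comp.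
- by move=> y; exact: (measurable_walk_preimage X [set val y]).
apply: filterS (ae_walk_bound _ XN) => w bX.
rewrite (bigD1 (Ordinal bX)) //= big1 ?addr0 => [|y yX].
  by rewrite indicE mem_set // mulr1.
rewrite indicE memNset ?mulr0 //= => Hy.
by move/eqP: yX; apply; apply: val_inj.
Qed.

(* [f] takes real arguments so that [f (y - 1)] makes sense at [y = 0], where
   it gets weight [0]. *)
Lemma expectation_walk_step X (f : R -> R) : (X < N)%N ->
  ('E_P[fun w => f (H X.+1 w)%:R]
   = 'E_P[fun w => ((1 - (H X w)%:R / (N%:R - X%:R)) * f ((H X w)%:R + 1)
                    + (H X w)%:R / (N%:R - X%:R) * f ((H X w)%:R - 1))%R])%E.
Proof.
move=> XN.
rewrite (expectation_walk X (fun y => (1 - y%:R / (N%:R - X%:R)) * f (y%:R + 1)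
  + y%:R / (N%:R - X%:R) * f (y%:R - 1)) (ltnW XN)).
(* Cells are indexed by a state [y] and a direction, [true] for up; [c] is the value of [f] after
   that step. *)
pose c (i : 'I_(Y0 + X).+1 * bool) : R :=
  if i.2 then f (i.1%:R + 1) else f (i.1%:R - 1).
pose A (i : 'I_(Y0 + X).+1 * bool) : set T :=
  (if i.2 then up X i.1 else down X i.1) `&` at_ X i.1.
rewrite (@expectation_ae_sum_indic _ _ _ _ _ _ c A).
- congr EFin; rewrite -(pair_bigA _ (fun y b => c (y, b) * fine (P (A (y, b))))) /=.
  apply: eq_bigr => y _; rewrite big_bool /c /A /= prob_up // prob_down //; ring.
- exact: (measurable_walk_comp X.+1 (fun y => f y%:R)).
- move=> [y b]; apply: measurableI; last exact: (measurable_walk_preimage X [set val y]).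
  by case: b; [exact: (measurable_walk_preimage X.+1 [set y.+1])
    |exact: (measurable_walk_preimage X.+1 [set k | k%:Z = y%:Z - 1])].
apply: filterS2 (ae_walk_bound _ (ltnW XN)) (ae_unit_step _ XN) => w bX step.
(* The point [w] lies in the cell of its current state and actual direction; all other cells miss
   it, since [y + 1] and [y - 1] differ. *)
have [b [Ab cb]] : exists b, A (Ordinal bX, b) w /\ c (Ordinal bX, b) = f (H X.+1 w)%:R.
  case: step => step; [exists true|exists false]; rewrite /A /c /=; do 2?split => //.
    by rewrite step -natr1.
  congr f; have := congr1 (fun z : int => z%:~R : R) step.
  by rewrite intrB -!pmulrn => ->.
rewrite (bigD1 (Ordinal bX, b)) //= big1 ?addr0 => [|[y b'] yX].
  by rewrite indicE mem_set // mulr1.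
rewrite indicE memNset ?mulr0 //; case=> step' /= Hy.
move/eqP: yX; apply; congr (_, _); first exact: val_inj.
move: Ab step'; rewrite /A /=.
by case: (b) (b') => [] [] //= [+ _]; rewrite /= -Hy; lia.
Qed.

End walk.

(* Reindexing the expansion of [x * ((x + 1) ^+ n - (x - 1) ^+ n)] by [k = j + 1]
   turns the sign [1 - (-1) ^+ (n - j)] into [1 + (-1) ^+ (n - k)]. *)
Lemma step_moment_expansion (R : comNzRingType) (x q : R) (n : nat) :
  (1 - x * q) * (x + 1) ^+ n + x * q * (x - 1) ^+ n
  = 1 + \sum_(1 <= k < n.+1)
      ('C(n, k)%:R - (1 + (-1) ^+ (n - k)) * 'C(n, k.-1)%:R * q) * x ^+ k.
Proof.
have -> : (1 - x * q) * (x + 1) ^+ n + x * q * (x - 1) ^+ n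
  = (1 + x) ^+ n - q * (x * ((1 + x) ^+ n - (-1 + x) ^+ n)).
  by rewrite [x + 1]addrC [x - 1]addrC; ring.
under eq_bigr do rewrite mulrBl; rewrite sumrB addrA; congr (_ - _).
  rewrite exprDn big_ord_recl /= expr0 subn0 expr1n mulr1 bin0; congr (_ + _).
  rewrite big_add1 /= big_mkord; apply: eq_bigr => i _.
  by rewrite expr1n mul1r /bump /= add1n mulr_natl.
(* The top terms [x ^+ n] of the two expansions cancel, so after multiplication by [x] the powers
   stop at [x ^+ n]. *)
rewrite 2!exprDn -sumrB big_ord_recr /= subnn !expr0 subrr addr0.
rewrite big_add1 /= big_mkord !mulr_sumr; apply: eq_bigr => i _.
rewrite expr1n -!(mulr_natl (_ * x ^+ i)) /= exprS.
have -> : (n - i = (n - i.+1).+1)%N by have := ltn_ord i; lia.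
rewrite [(-1) ^+ _.+1]exprS; ring.
Qed.

Theorem proposition2p1 (R : realType) (d : measure_display)
    (T : measurableType d) (P : probability T R) (N Y0 : nat)
    (H : nat -> {RV P >-> nat})
    (hN : (1 <= N)%N) (hY0 : (Y0 <= N)%N) (hpar : (Y0 = N %[mod 2])%N)
    (hH : area_random_walk N Y0 H) (n : nat) (hn : (1 <= n)%N) :
  (forall X : nat, (X < N)%N ->
     ('E_P[fun w => ((H X.+1 w)%:R ^+ n : R)%R]
     = 1 + \sum_(1 <= k < n.+1)
          ('C(n, k)%:R
           - (1 + (-1) ^+ (n - k)) * 'C(n, k.-1)%:R * (1 / (N%:R - X%:R)))%:E
          * 'E_P[fun w => ((H X w)%:R ^+ k : R)%R])%E)
  /\ ('E_P[fun w => ((H 0%N w)%:R ^+ n : R)%R] = (Y0%:R ^+ n)%:E)%E.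
Proof.
split=> [X XN|].
  have EX f := expectation_walk _ _ _ _ _ _ _ hH X f (ltnW XN).
  rewrite (expectation_walk_step _ _ _ _ _ _ _ hH X (fun x => x ^+ n) XN).
  rewrite (EX (fun y => (1 - y%:R / (N%:R - X%:R)) * (y%:R + 1) ^+ n
    + y%:R / (N%:R - X%:R) * (y%:R - 1) ^+ n)).
  under [in RHS]eq_bigr do rewrite (EX (fun y => y%:R ^+ _)) -EFinM.
  (* Writing the constant 1 as an expectation turns it into a sum over the same atoms, so the claim
     can be checked state by state. *)
  rewrite sumEFin -(expectation_cst P 1) (EX (fun=> 1)) -EFinD; congr EFin.
  under [X in _ = _ + X]eq_bigr do rewrite mulr_sumr.
  rewrite exchange_big -big_split; apply: eq_bigr => y _ /=.
  (* Here [x] is the state [y] and [q] is the inverse of [N - X]. *)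
  rewrite step_moment_expansion mulrDl mulr_suml; congr (_ + _).
  by apply: eq_bigr => k _; rewrite mul1r mulrA.
(* At time 0 the variable is almost surely constant: a single cell, the whole space. *)
rewrite (@expectation_ae_sum_indic _ _ _ _ 'I_1 _ (fun=> Y0%:R ^+ n) (fun=> setT)).
- by rewrite big_ord1 probability_setT mulr1.
- exact: (measurable_walk_comp _ _ _ _ _ 0 (fun y => y%:R ^+ n)).
- by [].
apply: filterS (ae_start _ _ _ _ _ _ _ hH) => w ->.
by rewrite big_ord1 indicE mem_set // mulr1.
Qed.
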